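(* Let $\triangle$ be a hyperbolic $n$-simplex in $H^n$ with vertices $p_1,\dots,p_{n+1}$ and edge matrix $M$, let $0\le k\le n-1$, let $W=\mathrm{span}\{p_1,\dots,p_{k+1}\}\subset R_1^{n+1}$, and let $W^h=W\cap H^n$ be the $k$-plane containing the $k$-face of $\triangle$ with vertices $p_1,\dots,p_{k+1}$. Let $p$ be a point of $H^n$. Then the orthogonal projection $\sigma(p)$ of $p$ to $W^h$ is given by $$ \sigma(p)=\frac{p+\displaystyle\sum_{s,t=k+2}^{n+1}\frac{\sqrt{M_{ss}M_{tt}}\; m_{t}^{s}\,\langle p,e_t\rangle}{|M|\,m^{k+1}}\,e_s}{\sqrt{1-\displaystyle\sum_{s,t=k+2}^{n+1}\frac{\sqrt{M_{ss}M_{tt}}\; m_{t}^{s}\,\langle p,e_t\rangle\langle p,e_s\rangle}{|M|\,m^{k+1}}}} . $$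
   Context: $R_1^{n+1}$ is $\mathbb{R}^{n+1}$ with the scalar product $\langle x,y\rangle=-x_1y_1+\sum_{i=2}^{n+1}x_iy_i$, and $H^n=\{x\in R_1^{n+1}: \langle x,x\rangle=-1,\ x_1>0\}$ is hyperbolic $n$-space with distance $\operatorname{arccosh}(-\langle p,q\rangle)$. A $k$-plane of $H^n$ is the intersection of $H^n$ with a $(k+1)$-dimensional time-like subspace (one containing a vector $v$ with $\langle v,v\rangle<0$). A hyperbolic $n$-simplex $\triangle$ has vertices $p_1,\dots,p_{n+1}\in H^n$ that are linearly independent in $R_1^{n+1}$. The edge matrix of $\triangle$ is $M=[\langle p_i,p_j\rangle]_{i,j=1,\dots,n+1}$; $|M|$ is its determinant and $M_{ij}$ is its $(i,j)$ cofactor (signed minor); so $M_{ii}$ is the determinant of $M$ with row and column $i$ deleted. The unit outer normal of the face opposite $p_i$ is $$e_i=\frac{\sum_{j=1}^{n+1}M_{ij}p_j}{\sqrt{M_{ii}|M|}},\qquad i=1,\dots,n+1.$$ $m^{k+1}$ is the determinant of the submatrix of $M$ with rows and columns $1,\dots,k+1$. For $i,j\in\{k+2,\dots,n+1\}$, $m_i^j$ is the determinant of the submatrix of $M$ with rows $1,\dots,k+1,i$ and columns $1,\dots,k+1,j$. The orthogonal projection (perpendicular foot) $\sigma(p)$ of $p$ to a $k$-plane is the point where the geodesic through $p$ meeting the $k$-plane orthogonally intersects the $k$-plane (and $\sigma(p)=p$ if $p$ lies in the $k$-plane). *)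

(* Defs.v *)
From HB Require Import structures.
From mathcomp Require Import all_boot all_order all_algebra.
From mathcomp Require Import reals.

Set Implicit Arguments.
Unset Strict Implicit.
Unset Printing Implicit Defensive.

Import Order.TTheory GRing.Theory Num.Theory.
Local Open Scope ring_scope.

(* Indices are shifted by one: the time coordinate x_1 is x 0 0, and the       *)
(* vertices p_1, ..., p_(k+1) are those of index at most k.                    *)

Definition lorentz (R : realType) (n : nat) (x y : 'rV[R]_n.+1) : R :=
  - (x 0 0 * y 0 0) + \sum_(i < n) x 0 (lift ord0 i) * y 0 (lift ord0 i).

Definition hyp_space (R : realType) (n : nat) : {pred 'rV[R]_n.+1} :=
  [pred x | (lorentz x x == -1) && (0 < x 0 0)].
Arguments hyp_space {R n}.

Definition timelike (R : realType) (n : nat) (W : {vspace 'rV[R]_n.+1}) : Prop :=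
  exists2 v, v \in W & lorentz v v < 0.

(* A k-plane of H^n is hyp_part W for a subspace W such that spans_plane k W.  *)
Definition hyp_part (R : realType) (n : nat) (W : {vspace 'rV[R]_n.+1}) :
    {pred 'rV[R]_n.+1} :=
  [pred x | (x \in W) && (x \in hyp_space)].

Definition spans_plane (R : realType) (n k : nat) (W : {vspace 'rV[R]_n.+1}) :
    Prop :=
  \dim W = k.+1 /\ timelike W.

(* The tangent space at q of the plane hyp_part W: as the tangent space of H^n *)
(* at q is the orthogonal of q, it consists of the w in W orthogonal to q.     *)
Definition tangent (R : realType) (n : nat) (W : {vspace 'rV[R]_n.+1})
    (q : 'rV[R]_n.+1) : {pred 'rV[R]_n.+1} :=
  [pred w | (w \in W) && (lorentz w q == 0)].

Definition meet_orthogonally (R : realType) (n : nat)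
    (U W : {vspace 'rV[R]_n.+1}) (q : 'rV[R]_n.+1) : Prop :=
  [/\ q \in hyp_part U, q \in hyp_part W &
      {in tangent U q & tangent W q, forall u w, lorentz u w = 0}].

(* q is the perpendicular foot of p on hyp_part W; geodesics are the 1-planes. *)
Definition is_foot (R : realType) (n : nat) (W : {vspace 'rV[R]_n.+1})
    (p q : 'rV[R]_n.+1) : Prop :=
  if p \in hyp_part W then q = p else
  exists U : {vspace 'rV[R]_n.+1},
    [/\ spans_plane 1 U, p \in hyp_part U & meet_orthogonally U W q].

Definition hyp_simplex (R : realType) (n : nat) (P : 'I_n.+1 -> 'rV[R]_n.+1) :
    Prop :=
  (forall i, P i \in hyp_space) /\ free [tuple P i | i < n.+1].

Definition edge_mx (R : realType) (n : nat) (P : 'I_n.+1 -> 'rV[R]_n.+1) :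
    'M[R]_n.+1 :=
  \matrix_(i, j) lorentz (P i) (P j).

Definition outer_normal (R : realType) (n : nat) (P : 'I_n.+1 -> 'rV[R]_n.+1)
    (i : 'I_n.+1) : 'rV[R]_n.+1 :=
  let M := edge_mx P in
  (Num.sqrt (cofactor M i i * \det M))^-1 *: \sum_j cofactor M i j *: P j.

Definition face_idx (n k : nat) (hk : (k < n)%N) : 'I_k.+1 -> 'I_n.+1 :=
  widen_ord (leqW hk).

Definition face_span (R : realType) (n k : nat) (hk : (k < n)%N)
    (P : 'I_n.+1 -> 'rV[R]_n.+1) : {vspace 'rV[R]_n.+1} :=
  <<[tuple P (face_idx hk a) | a < k.+1]>>%VS.

Definition face_minor (R : realType) (n k : nat) (hk : (k < n)%N)
    (M : 'M[R]_n.+1) : R :=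
  \det (mxsub (face_idx hk) (face_idx hk) M).

(* The k + 2 indices 1, ..., k + 1, i, in this order.                          *)
Definition bordered_idx (n k : nat) (hk : (k < n)%N) (i : 'I_n.+1)
    (a : 'I_(k.+1 + 1)) : 'I_n.+1 :=
  match split a with
  | inl b => face_idx hk b
  | inr _ => i
  end.

(* m_i^j: the border row is i and the border column is j.                      *)
Definition bordered_minor (R : realType) (n k : nat) (hk : (k < n)%N)
    (M : 'M[R]_n.+1) (i j : 'I_n.+1) : R :=
  \det (mxsub (bordered_idx hk i) (bordered_idx hk j) M).

(* Main.v *)
Require Import Defs.
From HB Require Import structures.
From mathcomp Require Import all_boot all_order all_algebra.
From mathcomp Require Import reals.
From mathcomp Require Import ring lra.

Set Implicit Arguments.
Unset Strict Implicit.
Unset Printing Implicit Defensive.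

Import Order.TTheory GRing.Theory Num.Theory.
Local Open Scope ring_scope.

(** Write <x, y> for the Lorentz form and W for the span of the first k+1
    vertices.  Since W contains a timelike vector, its orthogonal complement is
    positive definite, so every p has a unique decomposition p = y + z with y in
    W and z orthogonal to W.  Then <y, y> = -1 - <z, z> < 0, and the foot of a
    point p of hyperbolic space is y / sqrt (- <y, y>): the geodesic through p
    and a point q of W is orthogonal to W exactly when p + <p, q> q is
    orthogonal to W, that is, when y = - <p, q> q.  This is [is_footP].

    It remains to compute y.  Let P*_s be the basis dual to the vertices P_s for
    the Lorentz form, M the edge matrix, m the determinant of the face block of
    M and m_t^s its bordered minors.  The outer normal e_s is a rescaling of
    P*_s, and as |M| and all the M_ss are negative, the square roots combine to
    sqrt (M_ss M_tt) <p, e_t> e_s = - |M| <p, P*_t> P*_s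
    ([outer_normal_rescaling]).  So the numerator of the formula is
      p - sum_(s, t outside the face) (m_t^s / m) <p, P*_t> P*_s.
    Now m_t^s / m is a Schur complement, namely <P_t', P_s> for P_t' the
    component of P_t orthogonal to W ([bordered_minorE]); hence
    sum_s (m_t^s / m) P*_s = P_t' ([face_perp_expansion]).  Expanding p in the
    vertices, sum_t <p, P*_t> P_t' is the component z, so the numerator is y.
    The denominator is sqrt (- <p, y>), and <p, y> = <y, y>.

    Apart from the sign of |M|, read off M = A J A^T ([edge_mx_factor]), the
    signature arguments come from one identity, [time_mixedE], whose right-hand
    side is a sum of squares. *)

(** * The Lorentz form *)

Section LorentzForm.
Variables (R : realType) (n : nat).
Implicit Types (x y z : 'rV[R]_n.+1) (a : R).

Lemma lorentzC x y : lorentz x y = lorentz y x.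
Proof.
rewrite /lorentz mulrC; congr (_ + _).
by apply: eq_bigr => i _; rewrite mulrC.
Qed.

Lemma lorentzDl x y z : lorentz (x + y) z = lorentz x z + lorentz y z.
Proof.
rewrite /lorentz !mxE addrACA -big_split mulrDl opprD; congr (_ + _).
by apply: eq_bigr => i _; rewrite mxE mulrDl.
Qed.

Lemma lorentzZl a x y : lorentz (a *: x) y = a * lorentz x y.
Proof.
rewrite /lorentz mxE mulrDr mulr_sumr mulrN mulrA; congr (_ + _).
by apply: eq_bigr => i _; rewrite mxE mulrA.
Qed.

Lemma lorentzDr x y z : lorentz z (x + y) = lorentz z x + lorentz z y.
Proof. by rewrite lorentzC lorentzDl !(lorentzC z). Qed.

Lemma lorentzZr a x y : lorentz y (a *: x) = a * lorentz y x.
Proof. by rewrite lorentzC lorentzZl (lorentzC y). Qed.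

Lemma lorentzNl x y : lorentz (- x) y = - lorentz x y.
Proof. by rewrite -scaleN1r lorentzZl mulN1r. Qed.

Lemma lorentz0l x : lorentz 0 x = 0.
Proof. by rewrite -(scale0r 0) lorentzZl mul0r. Qed.

Lemma lorentzBl x y z : lorentz (x - y) z = lorentz x z - lorentz y z.
Proof. by rewrite lorentzDl lorentzNl. Qed.

Lemma lorentzBr x y z : lorentz z (x - y) = lorentz z x - lorentz z y.
Proof. by rewrite lorentzC lorentzBl !(lorentzC z). Qed.

Lemma lorentz_suml (I : Type) (r : seq I) (Q : pred I) (F : I -> 'rV[R]_n.+1) x :
  lorentz (\sum_(i <- r | Q i) F i) x = \sum_(i <- r | Q i) lorentz (F i) x.
Proof.
elim/big_rec2: _ => [|i a v _ <-]; first exact: lorentz0l.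
exact: lorentzDl.
Qed.

Lemma lorentz_sumr (I : Type) (r : seq I) (Q : pred I) (F : I -> 'rV[R]_n.+1) x :
  lorentz x (\sum_(i <- r | Q i) F i) = \sum_(i <- r | Q i) lorentz x (F i).
Proof. by rewrite lorentzC lorentz_suml; apply: eq_bigr => i _; rewrite lorentzC. Qed.

(** A Lorentzian substitute for the Cauchy-Schwarz inequality: the left side is
    the form evaluated at x_0 y - y_0 x, a vector whose time coordinate
    vanishes. *)
Lemma time_mixedE x y :
  x 0 0 ^+ 2 * lorentz y y + y 0 0 ^+ 2 * lorentz x x
    - 2 * (x 0 0 * y 0 0 * lorentz x y)
  = \sum_(i < n)
      (x 0 0 * y 0 (lift ord0 i) - y 0 0 * x 0 (lift ord0 i)) ^+ 2.
Proof.
rewrite /lorentz.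
have -> : \sum_(i < n)
      (x 0 0 * y 0 (lift ord0 i) - y 0 0 * x 0 (lift ord0 i)) ^+ 2
  = x 0 0 ^+ 2 * (\sum_(i < n) y 0 (lift ord0 i) * y 0 (lift ord0 i))
    + y 0 0 ^+ 2 * (\sum_(i < n) x 0 (lift ord0 i) * x 0 (lift ord0 i))
    - 2 * (x 0 0 * y 0 0) * (\sum_(i < n) x 0 (lift ord0 i) * y 0 (lift ord0 i)).
  rewrite !mulr_sumr -sumrN -!big_split /=.
  by apply: eq_bigr => i _; ring.
by ring.
Qed.

Lemma time_mixed_ge0 x y :
  0 <= x 0 0 ^+ 2 * lorentz y y + y 0 0 ^+ 2 * lorentz x x
         - 2 * (x 0 0 * y 0 0 * lorentz x y).
Proof. by rewrite time_mixedE sumr_ge0 // => i _; rewrite sqr_ge0. Qed.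

Lemma timelike_time_sqr_gt0 x : lorentz x x < 0 -> 0 < x 0 0 ^+ 2.
Proof.
rewrite /lorentz => h.
have : 0 <= \sum_(i < n) x 0 (lift ord0 i) * x 0 (lift ord0 i).
  by apply: sumr_ge0 => i _; rewrite -expr2 sqr_ge0.
move: h; rewrite expr2; lra.
Qed.

(** The orthogonal of a timelike vector is positive definite, stated as the
    implication by which vectors are shown to vanish below. *)
Lemma timelike_orthogonal_eq0 x v :
  lorentz x x < 0 -> lorentz x v = 0 -> lorentz v v <= 0 -> v = 0.
Proof.
move=> xx xv vv; have x0 := timelike_time_sqr_gt0 xx.
have := time_mixedE x v; have := time_mixed_ge0 x v.
rewrite xv !mulr0 subr0 => ge0 sqr.
have v0 : v 0 0 = 0.
  apply/eqP; rewrite -sqrf_eq0; apply/eqP.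
  have := sqr_ge0 (v 0 0); nra.
have vi (i : 'I_n) : v 0 (lift ord0 i) = 0.
  have eq0 : \sum_(j < n)
      (x 0 0 * v 0 (lift ord0 j) - v 0 0 * x 0 (lift ord0 j)) ^+ 2 = 0.
    by apply/eqP; rewrite eq_le -sqr ge0 v0 expr0n mul0r addr0 andbT; nra.
  have /eqP := psumr_eq0P (fun j _ => sqr_ge0 _) eq0 (i := i) isT.
  rewrite v0 mul0r subr0 sqrf_eq0 mulf_eq0 => /orP[/eqP x00|/eqP //].
  by move: x0; rewrite x00 expr0n ltxx.
apply/rowP => j; rewrite mxE.
by case: (unliftP ord0 j) => [i ->|->].
Qed.

Lemma timelike_orthogonal_gt0 x v :
  lorentz x x < 0 -> lorentz x v = 0 -> v != 0 -> 0 < lorentz v v.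
Proof.
move=> xx xv; apply: contraNT; rewrite -leNgt => vv.
by rewrite (timelike_orthogonal_eq0 xx xv vv).
Qed.

(** Both squares on the left of [time_mixedE] carry negative factors here.  This
    decides which half of the light cone a timelike vector lies in. *)
Lemma timelike_lorentz_sign x y :
  lorentz x x < 0 -> lorentz y y < 0 -> x 0 0 * y 0 0 * lorentz x y < 0.
Proof.
move=> xx yy; have := time_mixed_ge0 x y.
have := timelike_time_sqr_gt0 xx; have := timelike_time_sqr_gt0 yy.
nra.
Qed.

Lemma hyp_spaceP x : reflect (lorentz x x = -1 /\ 0 < x 0 0) (x \in hyp_space).
Proof. by rewrite inE; apply: (iffP andP) => -[/eqP]. Qed.

Lemma hyp_space_timelike x : x \in hyp_space -> lorentz x x < 0.
Proof. by case/hyp_spaceP => -> _; rewrite ltrN10. Qed.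

Lemma hyp_space_lorentz_lt0 x y :
  x \in hyp_space -> y \in hyp_space -> lorentz x y < 0.
Proof.
move=> hx hy.
have := timelike_lorentz_sign (hyp_space_timelike hx) (hyp_space_timelike hy).
have [_ x0] := hyp_spaceP _ hx; have [_ y0] := hyp_spaceP _ hy.
by rewrite pmulr_rlt0 // mulr_gt0.
Qed.

(** * Perpendicular feet *)

(** Projecting to hyperbolic space the orthogonal component of p in W gives the
    foot.  Conversely, a foot q yields the tangent vector p + <p, q> q at q of
    the geodesic; it is orthogonal to q and to the tangent space of W at q,
    which together span W. *)
Lemma is_footP (W : {vspace 'rV[R]_n.+1}) p y q :
    timelike W -> p \in hyp_space -> y \in W ->
    (forall w, w \in W -> lorentz (p - y) w = 0) ->
  is_foot W p q <-> q = (Num.sqrt (- lorentz y y))^-1 *: y.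
Proof.
move=> [v vW vv] hp yW orth.
have [pp p0] := hyp_spaceP _ hp.
have W0 z : z \in W -> (forall w, w \in W -> lorentz z w = 0) -> z = 0.
  move=> zW zo; apply: (timelike_orthogonal_eq0 vv).
    by rewrite lorentzC zo.
  by rewrite zo.
have py : lorentz p y = lorentz y y.
  by apply/eqP; rewrite -subr_eq0 -lorentzBl orth.
rewrite /is_foot inE hp andbT; case: ifPn => [pW|pW].
  have /eqP : p - y = 0 by apply: W0 => //; rewrite memvB.
  by rewrite subr_eq0 => /eqP <-; rewrite pp opprK sqrtr1 invr1 scale1r.
have yy : lorentz y y < 0.
  have : 0 < lorentz (p - y) (p - y).
    apply: (timelike_orthogonal_gt0 vv); first by rewrite lorentzC orth.
    by apply: contraNneq pW => /eqP; rewrite subr_eq0 => /eqP ->.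
  by rewrite lorentzBr (orth y) // subr0 lorentzBl pp (lorentzC y) py; lra.
have y0 : 0 < y 0 0.
  have := timelike_lorentz_sign (hyp_space_timelike hp) yy.
  rewrite py nmulr_llt0 // pmulr_rgt0 //.
have s_gt0 : 0 < Num.sqrt (- lorentz y y) by rewrite sqrtr_gt0 oppr_gt0.
split.
  case=> U [_ /andP[pU _] [/andP[qU hq] /andP[qW _] UW]].
  have [qq _] := hyp_spaceP _ hq.
  have pq := hyp_space_lorentz_lt0 hp hq.
  have uq : lorentz (p + lorentz p q *: q) q = 0.
    by rewrite lorentzDl lorentzZl qq mulrN1 subrr.
  have uW w : w \in W -> lorentz (p + lorentz p q *: q) w = 0.
    move=> wW.
    have <- : lorentz (p + lorentz p q *: q) (w + lorentz w q *: q)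
              = lorentz (p + lorentz p q *: q) w.
      by rewrite lorentzDr lorentzZr uq mulr0 addr0.
    apply: UW; rewrite inE; first by rewrite memvD ?memvZ //= uq.
    by rewrite memvD ?memvZ //= lorentzDl lorentzZl qq mulrN1 subrr.
  (* The difference of p + <p, q> q and p - y is in W and orthogonal to W. *)
  have /eqP : y + lorentz p q *: q = 0.
    apply: W0 => [|w wW]; first by rewrite memvD ?memvZ.
    have -> : y + lorentz p q *: q = p + lorentz p q *: q - (p - y).
      by rewrite opprB [RHS]addrC addrA subrK.
    by rewrite lorentzBl uW // orth // subrr.
  rewrite addr_eq0 -scaleNr => /eqP ->.
  rewrite lorentzZl lorentzZr qq mulrN1 mulrN opprK -expr2 sqrtr_sqr.
  by rewrite gtr0_norm ?oppr_gt0 // scalerA mulVf ?scale1r // oppr_eq0 lt_eqF.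
move=> ->; set s := Num.sqrt _ in s_gt0 *.
have s2 : s ^+ 2 = - lorentz y y by rewrite sqr_sqrtr // oppr_ge0 ltW.
have qH : s^-1 *: y \in hyp_space.
  apply/hyp_spaceP; rewrite lorentzZl lorentzZr mxE mulr_gt0 ?invr_gt0 //.
  split=> //; rewrite -[lorentz y y]opprK -s2; field; exact: lt0r_neq0.
have qW : s^-1 *: y \in W by rewrite memvZ.
have q0 : s^-1 *: y != 0.
  apply: contraTneq qH => ->; apply/negP => /hyp_spaceP [_].
  by rewrite mxE ltxx.
(* The geodesic from p to its foot spans a plane because p is not in W. *)
exists (<[p]> + <[s^-1 *: y]>)%VS; split.
- split; last by exists p; rewrite ?pp ?ltrN10 // memvE addvSl.
  rewrite dimv_disjoint_sum ?dim_vline ?q0.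
    suff -> : p != 0 by [].
    by apply: contraNneq pW => ->; rewrite mem0v.
  apply/eqP; rewrite -subv0; apply/subvP => z; rewrite memv_cap.
  case/andP => /vlineP[a ->] /vlineP[b ab].
  have [->|a0] := eqVneq a 0; first by rewrite scale0r mem0v.
  case/negP: pW; rewrite -[p](scalerK a0) ab; do 2!apply: memvZ; exact: qW.
- by rewrite inE hp andbT memvE addvSl.
- split=> [||u w]; rewrite inE ?qW ?qH ?andbT //.
    by rewrite memvE addvSr.
  case/andP=> /memv_addP[_ /vlineP[a ->] [_ /vlineP[b ->] ->]] _.
  rewrite inE => /andP[wW /eqP wq].
  rewrite lorentzDl !lorentzZl (lorentzC y).
  have yw : lorentz w y = 0.
    by move: wq; rewrite lorentzZr => /eqP; rewrite mulf_eq0 invr_eq0 gt_eqF //= => /eqP.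
  have : lorentz p w = lorentz y w.
    by apply/eqP; rewrite -subr_eq0 -lorentzBl orth.
  by rewrite (lorentzC y) yw => ->; rewrite !mulr0 addr0.
Qed.

End LorentzForm.

(** * Gram determinants *)

(** Block elimination of C. *)
Lemma det_block_schur (R : fieldType) (m l : nat) (A : 'M[R]_m)
    (B : 'M_(m, l)) (C : 'M_(l, m)) (D : 'M_l) :
  A \in unitmx ->
  \det (block_mx A B C D) = \det A * \det (D - C *m invmx A *m B).
Proof.
move=> uA.
have -> : block_mx A B C D
    = block_mx 1%:M 0 (C *m invmx A) 1%:M
      *m block_mx A B 0 (D - C *m invmx A *m B).
  rewrite mulmx_block !mul1mx !mul0mx !addr0.
  by rewrite mulmxKV // addrC subrK.
by rewrite det_mulmx det_lblock !det1 !mul1r det_ublock.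
Qed.

(** A kernel vector of the Gram matrix gives a combination of the v_a that is
    orthogonal to all of them, hence to itself and to a timelike vector, so it
    vanishes.  This serves both for the whole simplex and for its faces. *)
Lemma det_gram_neq0 (R : realType) (n m : nat) (v : 'I_m -> 'rV[R]_n.+1)
    (i0 : 'I_m) :
    lorentz (v i0) (v i0) < 0 ->
    (forall u : 'I_m -> R, \sum_a u a *: v a = 0 -> forall a, u a = 0) ->
  \det (\matrix_(a, b) lorentz (v a) (v b)) != 0.
Proof.
move=> tl indep; apply/negP => /det0P [u u0 uM].
have orth b : lorentz (\sum_a u 0 a *: v a) (v b) = 0.
  move/rowP/(_ b): uM; rewrite !mxE lorentz_suml => {2}<-.
  by apply: eq_bigr => a _; rewrite mxE lorentzZl.
case/eqP: u0; apply/rowP => a; rewrite mxE; apply: indep.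
apply: (timelike_orthogonal_eq0 tl); first by rewrite lorentzC.
rewrite lorentz_sumr big1 // => b _.
by rewrite lorentzZr orth mulr0.
Qed.

(** * The dual basis of a simplex *)

Section Simplex.
Variables (R : realType) (n : nat) (P : 'I_n.+1 -> 'rV[R]_n.+1).
Hypothesis hP : hyp_simplex P.
Let M := edge_mx P.

Lemma vertex_timelike i : lorentz (P i) (P i) < 0.
Proof. exact/hyp_space_timelike/(proj1 hP). Qed.

Lemma edge_mxC i j : M i j = M j i.
Proof. by rewrite !mxE lorentzC. Qed.

Lemma simplex_indep (u : 'I_n.+1 -> R) :
  \sum_i u i *: P i = 0 -> forall i, u i = 0.
Proof.
move=> sum0; have /freeP := proj2 hP; apply.
by rewrite -[RHS]sum0; apply: eq_bigr => i _; rewrite -tnth_nth tnth_mktuple.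
Qed.

Lemma det_edge_neq0 : \det M != 0.
Proof. exact: det_gram_neq0 (vertex_timelike ord0) simplex_indep. Qed.

(** The Gram matrix as a congruence of the matrix of the form; it gives |M| the
    sign of the form's determinant, -1. *)
Lemma edge_mx_factor :
  M = (\matrix_i P i) *m diag_mx (\row_j (if j == 0 then -1 else 1))
        *m (\matrix_i P i)^T.
Proof.
apply/matrixP => i j; rewrite !mxE /lorentz big_ord_recl.
rewrite mul_mx_diag !mxE /= mulrN1 mulNr; congr (_ + _).
by apply: eq_bigr => l _; rewrite !mxE /= mulr1.
Qed.

Lemma det_edge_sqr : \det M = - (\det (\matrix_i P i)) ^+ 2.
Proof.
rewrite edge_mx_factor !det_mulmx det_tr det_diag big_ord_recl mxE /=.
by rewrite big1 ?mulr1 => [|i _]; [ring | rewrite mxE].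
Qed.

Lemma det_edge_lt0 : \det M < 0.
Proof. by rewrite lt_neqAle det_edge_neq0 det_edge_sqr oppr_le0 sqr_ge0. Qed.

Definition dual_vertex (i : 'I_n.+1) : 'rV[R]_n.+1 :=
  (\det M)^-1 *: \sum_j cofactor M i j *: P j.

(** The cofactor expansion M adj(M) = |M|, read in the vertices. *)
Lemma lorentz_dual_vertex i l : lorentz (dual_vertex i) (P l) = (i == l)%:R.
Proof.
rewrite lorentzZl lorentz_suml.
have /matrixP/(_ l i) := mul_mx_adj M.
rewrite [LHS]mxE [RHS]mxE => e.
rewrite (eq_bigr (fun j => M l j * \adj M j i)); last first.
  by move=> j _; rewrite lorentzZl [\adj M _ _]mxE edge_mxC mulrC [M j l]mxE.
by rewrite e mulrnAr mulVf ?det_edge_neq0 // eq_sym.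
Qed.

Lemma vertex_expansion x : x = \sum_t lorentz x (dual_vertex t) *: P t.
Proof.
have uP : (\matrix_i P i) \in unitmx.
  rewrite unitmxE unitfE; apply: contraNneq det_edge_neq0 => d0.
  by rewrite det_edge_sqr d0 expr0n oppr0.
have xE : x = \sum_t (x *m invmx (\matrix_i P i)) 0 t *: P t.
  rewrite -[LHS](mulmxKV uP) mulmx_sum_row.
  by apply: eq_bigr => t _; rewrite rowK.
rewrite {1}xE; apply: eq_bigr => t _; congr (_ *: _).
rewrite [in RHS]xE lorentz_suml (bigD1 t) //= lorentzZl lorentzC lorentz_dual_vertex.
rewrite eqxx mulr1 big1 ?addr0 // => s st.
by rewrite lorentzZl lorentzC lorentz_dual_vertex eq_sym (negPf st) mulr0.
Qed.

(** Both sides have the same products with the vertices; their difference is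
    then orthogonal to all vectors, in particular to itself. *)
Lemma dual_expansion x : x = \sum_s lorentz x (P s) *: dual_vertex s.
Proof.
apply/eqP; rewrite -subr_eq0; apply/eqP; set z := x - _.
have zP t : lorentz z (P t) = 0.
  rewrite lorentzBl lorentz_suml (bigD1 t) //= lorentzZl lorentz_dual_vertex.
  rewrite eqxx mulr1 big1 ?addr0 ?subrr // => s st.
  by rewrite lorentzZl lorentz_dual_vertex (negPf st) mulr0.
apply: (timelike_orthogonal_eq0 (vertex_timelike ord0)).
  by rewrite lorentzC.
rewrite [X in lorentz _ X]vertex_expansion lorentz_sumr big1 // => t _.
by rewrite lorentzZr zP mulr0.
Qed.

Hypothesis n_gt0 : (0 < n)%N.

(** M_ii / |M| is the square norm of the dual vector i, which is spacelike
    because it is orthogonal to any other vertex. *)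
Lemma principal_cofactor_lt0 i : cofactor M i i < 0.
Proof.
have normE : lorentz (dual_vertex i) (dual_vertex i)
             = (\det M)^-1 * cofactor M i i.
  rewrite {2}/dual_vertex lorentzZr lorentz_sumr (bigD1 i) //=.
  rewrite lorentzZr lorentz_dual_vertex eqxx mulr1 big1 ?addr0 // => j ji.
  by rewrite lorentzZr lorentz_dual_vertex eq_sym (negPf ji) mulr0.
have [j ji] : exists j, i != j.
  have [i0|i0] := eqVneq i ord0; last by exists ord0.
  by exists ord_max; rewrite i0 -val_eqE /= neq_ltn n_gt0.
have : 0 < lorentz (dual_vertex i) (dual_vertex i).
  apply: (timelike_orthogonal_gt0 (vertex_timelike j)).
    by rewrite lorentzC lorentz_dual_vertex (negPf ji).
  apply: contraTneq isT => d0; have := lorentz_dual_vertex i i.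
  by rewrite d0 lorentz0l eqxx => /eqP; rewrite eq_sym oner_eq0.
by rewrite normE nmulr_rgt0 // invr_lt0 det_edge_lt0.
Qed.

Lemma outer_normalE i :
  outer_normal P i
  = (\det M / Num.sqrt (cofactor M i i * \det M)) *: dual_vertex i.
Proof.
rewrite /outer_normal /dual_vertex scalerA; congr (_ *: _).
by rewrite [RHS]mulrAC divff ?det_edge_neq0 // mul1r.
Qed.

(** The product of the two scaling factors of [outer_normalE] carries the
    absolute value of |M|, whence the sign on the right. *)
Lemma outer_normal_rescaling s t :
  Num.sqrt (cofactor M s s * cofactor M t t)
    * (\det M / Num.sqrt (cofactor M s s * \det M))
    * (\det M / Num.sqrt (cofactor M t t * \det M)) = - \det M.
Proof.
have D := det_edge_lt0.
have Ms := principal_cofactor_lt0 s; have Mt := principal_cofactor_lt0 t.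
have sE : Num.sqrt (cofactor M s s * \det M) * Num.sqrt (cofactor M t t * \det M)
          = Num.sqrt (cofactor M s s * cofactor M t t) * (- \det M).
  rewrite -(ltr0_norm D) -sqrtr_sqr -!sqrtrM ?ltW ?nmulr_rgt0 //.
  by congr Num.sqrt; ring.
have st0 : 0 < Num.sqrt (cofactor M s s * cofactor M t t).
  by rewrite sqrtr_gt0 nmulr_rgt0.
have pos i : cofactor M i i < 0 -> Num.sqrt (cofactor M i i * \det M) != 0.
  by move=> Mi; rewrite gt_eqF // sqrtr_gt0 nmulr_rgt0.
move: sE (pos s Ms) (pos t Mt) (gt_eqF st0).
set z := Num.sqrt (_ * cofactor _ _ _); set a := Num.sqrt _; set b := Num.sqrt _.
move=> sE a0 b0 /negbT z0.
have -> : z * (\det M / a) * (\det M / b) = z * \det M ^+ 2 / (a * b).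
  by field; rewrite a0 b0.
by rewrite sE; field; rewrite z0 det_edge_neq0.
Qed.

(** * The face plane *)

Variables (k : nat) (hk : (k < n)%N).
Let f := face_idx hk.
Let MK : 'M[R]_k.+1 := mxsub f f M.

Lemma vertex_in_face a : P (f a) \in face_span hk P.
Proof.
by apply: memv_span; apply/tnthP; exists a; rewrite tnth_mktuple.
Qed.

Lemma face_idx_of_le (t : 'I_n.+1) : (t <= k)%N -> exists a, t = f a.
Proof. by move=> tk; exists (Ordinal (tk : (t < k.+1)%N)); apply: val_inj. Qed.

Lemma face_orthogonal x :
    (forall a, lorentz x (P (f a)) = 0) ->
  forall w, w \in face_span hk P -> lorentz x w = 0.
Proof.
move=> xo w /coord_span ->; rewrite lorentz_sumr big1 // => a _.
by rewrite lorentzZr -tnth_nth tnth_mktuple xo mulr0.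
Qed.

(** The vertices of the face are independent because pairing with the dual
    vectors recovers the coefficients. *)
Lemma face_minor_neq0 : face_minor hk M != 0.
Proof.
have -> : face_minor hk M = \det (\matrix_(a, b) lorentz (P (f a)) (P (f b))).
  by congr (\det _); apply/matrixP => a b; rewrite !mxE.
apply: (det_gram_neq0 (i0 := ord0)) => [|u sum0 a]; first exact: vertex_timelike.
have := lorentz0l (dual_vertex (f a)); rewrite -sum0 lorentz_suml (bigD1 a) //=.
rewrite lorentzZl lorentzC lorentz_dual_vertex eqxx mulr1 big1 ?addr0 // => b ba.
rewrite lorentzZl lorentzC lorentz_dual_vertex.
by rewrite -val_eqE /= val_eqE eq_sym (negPf ba) mulr0.
Qed.

Lemma face_mx_unit : MK \in unitmx.
Proof. by rewrite unitmxE unitfE face_minor_neq0. Qed.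

(** The component of the vertex t orthogonal to the face plane: the
    coefficients of the subtracted part solve the normal equations. *)
Definition face_perp (t : 'I_n.+1) : 'rV[R]_n.+1 :=
  P t - \sum_a ((\row_b M t (f b)) *m invmx MK) 0 a *: P (f a).

Lemma face_perp_in t : P t - face_perp t \in face_span hk P.
Proof.
rewrite opprB addrC addrNK; apply: memv_suml => a _.
exact/memvZ/vertex_in_face.
Qed.

(** The product is a Schur complement of the face block in the bordered block. *)
Lemma lorentz_face_perp t s :
  lorentz (face_perp t) (P s)
  = M t s
    - (\row_b M t (f b) *m invmx MK *m \col_a M (f a) s) 0 (0 : 'I_1).
Proof.
rewrite lorentzBl lorentz_suml [M t s]mxE; congr (_ - _).
by rewrite [RHS]mxE; apply: eq_bigr => a _; rewrite lorentzZl !mxE.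
Qed.

Lemma face_perp_orthogonal t a : lorentz (face_perp t) (P (f a)) = 0.
Proof.
rewrite lorentz_face_perp.
have -> : \col_b M (f b) (f a) = MK *m delta_mx a (0 : 'I_1).
  by rewrite -colE; apply/colP => b; rewrite !mxE.
rewrite mulmxA mulmxKV ?face_mx_unit // -colE !mxE.
by rewrite subrr.
Qed.

Lemma bordered_minorE t s :
  bordered_minor hk M t s = face_minor hk M * lorentz (face_perp t) (P s).
Proof.
rewrite lorentz_face_perp.
have -> : bordered_minor hk M t s = \det (block_mx MK (\col_a M (f a) s)
            (\row_b M t (f b)) (M t s)%:M).
  congr (\det _); apply/matrixP => a b; rewrite !mxE /bordered_idx.
  by case: (split a) => a'; rewrite !mxE; case: (split b) => b'; rewrite !mxE ?ord1 ?eqxx.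
rewrite det_block_schur ?face_mx_unit // [in RHS]/face_minor.
congr (_ * _); rewrite [X in \det X]mx11_scalar det_scalar1 [LHS]mxE [in LHS]mxE.
by congr (_ + _); rewrite mxE.
Qed.

(** In the dual basis the coordinates are products with the vertices; those with
    the vertices of the face vanish. *)
Lemma face_perp_expansion t :
  face_perp t
  = \sum_(s < n.+1 | (k < s)%N)
      (bordered_minor hk M t s / face_minor hk M) *: dual_vertex s.
Proof.
rewrite [LHS]dual_expansion (bigID (fun s : 'I_n.+1 => (k < s)%N)) /=.
rewrite [X in _ + X]big1 ?addr0 => [|s].
  apply: eq_bigr => s _; rewrite bordered_minorE mulrAC divff ?mul1r //.
  exact: face_minor_neq0.
rewrite -leqNgt => /face_idx_of_le[a ->].
by rewrite face_perp_orthogonal scale0r.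
Qed.

End Simplex.

Theorem theorem2p1 (R : realType) (n k : nat) (hk : (k < n)%N)
    (P : 'I_n.+1 -> 'rV[R]_n.+1) (hP : hyp_simplex P)
    (p : 'rV[R]_n.+1) (hp : p \in hyp_space) (q : 'rV[R]_n.+1) :
  let M := edge_mx P in
  let e := outer_normal P in
  let c (s t : 'I_n.+1) : R :=
    Num.sqrt (cofactor M s s * cofactor M t t) * bordered_minor hk M t s in
  let d : R := \det M * face_minor hk M in
  is_foot (face_span hk P) p q <->
  q = (Num.sqrt
         (1 - \sum_(s < n.+1 | (k < s)%N) \sum_(t < n.+1 | (k < t)%N)
                c s t * lorentz p (e t) * lorentz p (e s) / d))^-1 *:
      (p + \sum_(s < n.+1 | (k < s)%N) \sum_(t < n.+1 | (k < t)%N)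
             (c s t * lorentz p (e t) / d) *: e s).
Proof.
move=> M e c d.
have n_gt0 : (0 < n)%N := leq_ltn_trans (leq0n k) hk.
set N := \sum_(s < n.+1 | _) \sum_(t < n.+1 | _) _ *: _.
(* N is minus the component of p orthogonal to the face plane. *)
have NE : N = - \sum_(t < n.+1 | (k < t)%N)
                  lorentz p (dual_vertex P t) *: face_perp P hk t.
  rewrite /N exchange_big -sumrN; apply: eq_bigr => t _ /=.
  rewrite (face_perp_expansion hP) scaler_sumr -sumrN; apply: eq_bigr => s _.
  rewrite /e !outer_normalE // lorentzZr !scalerA -scaleNr; congr (_ *: _).
  have := outer_normal_rescaling hP n_gt0 s t.
  have := face_minor_neq0 hP hk; have := det_edge_neq0 hP.
  rewrite -/M /c /d.
  set x := _ / _; set y := _ / _; set z := Num.sqrt _.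
  move=> D m xyz.
  rewrite (_ : _ * x = (z * x * y) * bordered_minor hk M t s
     * lorentz p (dual_vertex P t) / (\det M * face_minor hk M)); last by ring.
  by rewrite xyz; field; rewrite D m.
have tW : timelike (face_span hk P).
  by exists (P (face_idx hk ord0)); [exact: vertex_in_face | exact: vertex_timelike].
have pN_orth w : w \in face_span hk P -> lorentz (p - (p + N)) w = 0.
  move=> wW; rewrite opprD addNKr NE opprK lorentz_suml big1 // => t _.
  rewrite lorentzZl (face_orthogonal (face_perp_orthogonal hP hk t)) ?mulr0 //.
have pN_in : p + N \in face_span hk P.
  rewrite NE {1}[p](vertex_expansion hP).
  (* The vertices outside the face keep only their component in the plane. *)
  rewrite (bigID (fun s : 'I_n.+1 => (k < s)%N)) /= addrAC -sumrB.
  apply: memvD; apply: memv_suml => t kt.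
    by rewrite -scalerBr memvZ // face_perp_in.
  move: kt; rewrite -leqNgt => /(face_idx_of_le hk) [a ->].
  exact/memvZ/vertex_in_face.
have normE : 1 - \sum_(s < n.+1 | (k < s)%N) \sum_(t < n.+1 | (k < t)%N)
                c s t * lorentz p (e t) * lorentz p (e s) / d
             = - lorentz (p + N) (p + N).
  have -> : lorentz (p + N) (p + N) = lorentz p (p + N).
    by apply/eqP; rewrite eq_sym -subr_eq0 -lorentzBl pN_orth.
  have [pp _] := hyp_spaceP _ hp.
  rewrite lorentzDr pp opprD opprK; congr (_ - _).
  rewrite lorentz_sumr; apply: eq_bigr => s _.
  rewrite lorentz_sumr; apply: eq_bigr => t _.
  by rewrite lorentzZr mulrAC.
rewrite normE; exact: is_footP.
Qed.
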